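(* Let $(S,\rho)$ be a separable compact metric space and let $S^\infty$ be the set of finite subsets of $S$. Then the space $(S^\infty,d_H)$, where $d_H$ is the Hausdorff distance, is separable.
   Context: $S^\infty=\{x\subset S:\#x<\infty\}$, where $\#x$ is the cardinality of $x$. Given two non-empty compact sets $A,C\subset S$, the Hausdorff distance between them is $d_H(A,C)=\max\{\sup_{a\in A}d(a,C),\ \sup_{c\in C}d(c,A)\}$, where $d(a,C)=\inf\{\rho(a,c):c\in C\}$. Since $S$ is bounded and every $x\in S^\infty$ is finite, $d_H$ is regarded as a well-defined metric on $S^\infty$. *)

(* Defs.v *)
From HB Require Import structures.
From mathcomp Require Import all_boot all_order all_algebra.
From mathcomp Require Import finmap.
From mathcomp Require Import all_classical all_reals all_analysis.

Set Implicit Arguments.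
Unset Strict Implicit.
Unset Printing Implicit Defensive.

Import Order.TTheory GRing.Theory Num.Theory.

Local Open Scope classical_set_scope.
Local Open Scope ring_scope.
Local Open Scope ereal_scope.

Definition separable_space (T : topologicalType) : Prop :=
  exists2 D : set T, countable D & dense D.

Section hausdorff_distance.
Context {R : realType} {S : metricType R}.
Implicit Types (a b c : S) (A B C : set S) (e : R).

Definition set_dist a C : \bar R := ereal_inf [set (mdist a c)%:E | c in C].

(* Values are taken in [0, +oo], where the infimum of the empty set is +oo and
   its supremum is 0 (`ereal_sup set0` is -oo, hence the `maxe 0`).  On
   nonempty sets the `maxe 0` is redundant (see hausdorff_distE); the empty set
   is at distance 0 from itself and +oo from every nonempty set. *)
Definition hausdorff_dist A C : \bar R :=
  maxe 0 (maxe (ereal_sup [set set_dist a C | a in A])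
               (ereal_sup [set set_dist c A | c in C])).

Lemma set_dist_ge0 a C : 0 <= set_dist a C.
Proof. by apply: le_ereal_inf_tmp => _ [c _ <-]; rewrite lee_fin mdist_ge0. Qed.

Lemma set_dist_le a c C : C c -> set_dist a C <= (mdist a c)%:E.
Proof. by move=> Cc; apply: ereal_inf_lbound; exists c. Qed.

Lemma hausdorff_dist_ge0 A C : 0 <= hausdorff_dist A C.
Proof. by rewrite /hausdorff_dist le_max lexx. Qed.

Lemma hausdorff_distE A C : A !=set0 ->
  hausdorff_dist A C = maxe (ereal_sup [set set_dist a C | a in A])
                            (ereal_sup [set set_dist c A | c in C]).
Proof.
move=> [a Aa]; rewrite /hausdorff_dist; apply/max_idPr; rewrite le_max.
apply/orP; left; apply: le_trans (set_dist_ge0 a C) _.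
by apply: ereal_sup_ubound; exists a.
Qed.

Lemma hausdorff_dist_leP A C (r : \bar R) : 0 <= r ->
  hausdorff_dist A C <= r <->
  (forall a, A a -> set_dist a C <= r) /\ (forall c, C c -> set_dist c A <= r).
Proof.
move=> r0; rewrite /hausdorff_dist !ge_max r0 /=; split.
  move=> /andP[h1 h2]; split=> x Ax.
    by apply: le_trans h1; apply: ereal_sup_ubound; exists x.
  by apply: le_trans h2; apply: ereal_sup_ubound; exists x.
move=> [h1 h2]; apply/andP; split; apply: ge_ereal_sup => _ [x Ax <-].
  exact: h1.
exact: h2.
Qed.

Lemma hausdorff_distxx A : hausdorff_dist A A = 0.
Proof.
apply/eqP; rewrite eq_le hausdorff_dist_ge0 andbT.
have h a : A a -> set_dist a A <= 0.
  by move=> Aa; rewrite -[0]/(0%:E) -(mdistxx a); exact: set_dist_le.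
by apply/hausdorff_dist_leP.
Qed.

Lemma hausdorff_dist_sym A C : hausdorff_dist A C = hausdorff_dist C A.
Proof. by rewrite /hausdorff_dist [X in maxe 0 X]maxC. Qed.

Let set_dist_triangle a A B C : A a ->
  set_dist a C <= hausdorff_dist A B + hausdorff_dist B C.
Proof.
move=> Aa.
have [hA _] := (hausdorff_dist_leP A B (hausdorff_dist_ge0 A B)).1 (lexx _).
have [hB _] := (hausdorff_dist_leP B C (hausdorff_dist_ge0 B C)).1 (lexx _).
apply: (le_trans _ (leeD (hA _ Aa) (lexx _))).
have := hausdorff_dist_ge0 B C.
case: (hausdorff_dist B C) hB => [s| |] // hB _; last first.
  by rewrite addey ?leey// -ltNye (lt_le_trans _ (set_dist_ge0 _ _)).
rewrite -leeBlDr//; apply: le_ereal_inf_tmp => _ [b Bb <-].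
rewrite leeBlDr//; apply/lee_addgt0Pr => e e0.
have : set_dist b C < (s + e)%:E.
  by rewrite (le_lt_trans (hB _ Bb))// lte_fin ltrDl.
move=> /ereal_inf_lt[_ [c Cc <-]]; rewrite lte_fin => bc.
apply: le_trans (set_dist_le a Cc) _.
rewrite -!EFinD lee_fin (le_trans (metric_triangle _ b _))// -addrA lerD2l.
exact: ltW.
Qed.

Lemma hausdorff_dist_triangle A B C :
  hausdorff_dist A C <= hausdorff_dist A B + hausdorff_dist B C.
Proof.
apply/hausdorff_dist_leP; first by rewrite adde_ge0// hausdorff_dist_ge0.
split=> x Xx; first exact: set_dist_triangle.
rewrite addeC hausdorff_dist_sym [X in _ + X]hausdorff_dist_sym.
exact: set_dist_triangle.
Qed.

Let fset_dist_gt0 a (C : {fset S}) : a \notin C -> 0 < set_dist a [set` C].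
Proof.
move=> aC; pose m := \big[Order.min/1%R]_(c <- C) mdist a c.
apply: (@lt_le_trans _ _ m%:E).
  rewrite lte_fin /m big_seq; elim/big_ind : _ => // [x y x0 y0|c cC].
    by rewrite lt_min x0.
  by rewrite mdist_gt0; apply: contraNneq aC => ->.
apply: le_ereal_inf_tmp => _ [c cC <-].
by rewrite lee_fin /m; exact: ge_bigmin_seq.
Qed.

Lemma hausdorff_dist_eq0 (A C : {fset S}) :
  hausdorff_dist [set` A] [set` C] = 0 -> A = C.
Proof.
move=> h; have [hA hC] : (forall a, [set` A] a -> set_dist a [set` C] <= 0) /\
    (forall c, [set` C] c -> set_dist c [set` A] <= 0).
  by apply/hausdorff_dist_leP; rewrite ?h.
apply/fsetP => x; apply/idP/idP => [/hA|/hC]; apply: contraLR => /fset_dist_gt0.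
  by rewrite ltNge.
by rewrite ltNge.
Qed.

Lemma hausdorff_dist_fin_num (A C : {fset S}) :
  A != fset0 -> C != fset0 -> hausdorff_dist [set` A] [set` C] \is a fin_num.
Proof.
move=> /fset0Pn[a0 a0A] /fset0Pn[c0 c0C].
pose m := \big[Order.max/0%R]_(a <- A) \big[Order.max/0%R]_(c <- C) mdist a c.
have mP a c : a \in A -> c \in C -> (mdist a c <= m)%R.
  move=> aA cC; apply: bigmax_sup_seq aA _ _ => //.
  exact: bigmax_sup_seq cC _ _.
have m0 : 0 <= m%:E by rewrite lee_fin (le_trans _ (mP _ _ a0A c0C))// mdist_ge0.
rewrite ge0_fin_numE ?hausdorff_dist_ge0// (@le_lt_trans _ _ m%:E) ?ltry//.
apply/hausdorff_dist_leP => //; split=> [a aA|c cC].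
  by apply: le_trans (set_dist_le _ c0C) _; rewrite lee_fin mP.
by apply: le_trans (set_dist_le _ a0A) _; rewrite lee_fin metric_sym mP.
Qed.

End hausdorff_distance.

(* An alias of {fset S} carrying the topology of the Hausdorff distance. *)
Definition finite_subsets {R : realType} (S : metricType R) : Type := {fset S}.

Section finite_subsets_topology.
Context {R : realType} (S : metricType R).
Local Notation F := (finite_subsets S).

HB.instance Definition _ := Choice.copy F {fset S}.

Let dH (A C : F) : \bar R := hausdorff_dist [set` (A : {fset S})] [set` (C : {fset S})].

Let ball (A : F) (e : R) : set F := [set C | dH A C < e%:E].

Let ent : set_system (F * F) := entourage_ ball.

HB.instance Definition _ := hasNbhs.Build F (nbhs_ ent).

Let ball_center (A : F) (e : R) : (0 < e)%R -> ball A e A.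
Proof. by move=> e0; rewrite /ball /dH/= hausdorff_distxx lte_fin. Qed.

Let ball_sym (A C : F) (e : R) : ball A e C -> ball C e A.
Proof. by rewrite /ball /dH/= hausdorff_dist_sym. Qed.

Let ball_triangle (A B C : F) (e1 e2 : R) :
  ball A e1 B -> ball B e2 C -> ball A (e1 + e2) C.
Proof.
rewrite /ball /dH/= => AB BC; rewrite EFinD.
by apply: le_lt_trans (hausdorff_dist_triangle _ [set` (B : {fset S})] _) (lteD _ _).
Qed.

(* The library's metricType requires a real-valued distance, whereas the empty
   set is here at distance +oo from the others: the balls of dH equip the finite
   subsets with a pseudometric structure in the library's (ball-based) sense. *)
HB.instance Definition _ := @Nbhs_isPseudoMetric.Build R F
  ent erefl ball ball_center ball_sym ball_triangle erefl.

Lemma ball_finite_subsetsE (A : F) (e : R) : pseudometric_structure.ball A e =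
  [set C : F | hausdorff_dist [set` (A : {fset S})] [set` (C : {fset S})] < e%:E].
Proof. by []. Qed.

End finite_subsets_topology.

(* Main.v *)
(* If D is countable and dense in S, then the finite subsets of D are countably
   many, and moving each point of a finite set A by at most e into D yields a
   finite subset of D at Hausdorff distance at most e from A. *)
Require Import Defs.
From mathcomp Require Import all_boot all_order all_algebra.
From mathcomp Require Import finmap.
From mathcomp Require Import all_classical all_reals all_analysis.

Set Implicit Arguments.
Unset Strict Implicit.
Unset Printing Implicit Defensive.

Import Order.TTheory GRing.Theory Num.Theory.

Local Open Scope classical_set_scope.
Local Open Scope ring_scope.

(** An injection [f] of [D] into [nat] induces, by taking images, an injection of these finite sets
    into the countable type [{fset nat}]. *)
Lemma countable_fsubsets (T : choiceType) (D : set T) : countable D ->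
  countable [set A : {fset T} | [set` A] `<=` D].
Proof.
move=> /countable_injP[f f_inj].
have imf_inj : {in [set A : {fset T} | [set` A] `<=` D] &,
    injective (fun A : {fset T} => (f @` A)%fset)}.
  move=> A B; rewrite !inE => AD BD fAB.
  (* [f] is injective only on [D], so both sets must lie in [D]; exchanging [X] and [Y] gives the
     reverse inclusion. *)
  have sub (X Y : {fset T}) : [set` X] `<=` D -> [set` Y] `<=` D ->
      (f @` X)%fset = (f @` Y)%fset -> {subset X <= Y}.
    move=> XD YD fXY x xX.
    have /imfsetP[y /= yY fxy] : f x \in (f @` Y)%fset by rewrite -fXY in_imfset.
    by rewrite (f_inj x y _ _ fxy)// inE; [exact: XD|exact: YD].
  by apply/fsetP => x; apply/idP/idP; exact: sub.
rewrite -(eq_countable (inj_card_eq imf_inj)).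
exact: countableP.
Qed.

(** The pairs [(a, f a)] match [A] with its image in both directions. For empty [A] the distance is
    0, covered by [0 <= e]. *)
Lemma hausdorff_dist_imfset_le (R : realType) (S : metricType R) (f : S -> S)
    (A : {fset S}) (e : R) : 0 <= e -> (forall a, a \in A -> mdist a (f a) <= e) ->
  (hausdorff_dist [set` A] [set` (f @` A)%fset] <= e%:E)%E.
Proof.
move=> e0 fe; apply/hausdorff_dist_leP; rewrite ?lee_fin//; split.
  move=> a aA; have faC : [set` (f @` A)%fset] (f a) by rewrite /= in_imfset.
  by rewrite (le_trans (set_dist_le _ faC))// lee_fin fe.
move=> _ /imfsetP[/= a aA ->].
by rewrite (le_trans (set_dist_le _ aA))// lee_fin metric_sym fe.
Qed.

Theorem proposition1 (R : realType) (S : metricType R)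
    (S_separable : separable_space S) (S_compact : compact [set: S]) :
  separable_space (finite_subsets S).
Proof.
have [D D_countable D_dense] := S_separable.
exists [set A : {fset S} | [set` A] `<=` D]; first exact: countable_fsubsets.
move=> U [A UA] U_open.
have /nbhs_ballP[e /= e0 eU] : nbhs A U by exact: open_nbhs_nbhs.
(* Halving turns the non-strict bound on the Hausdorff distance into the strict one that defines the
   ball. *)
have e20 : 0 < e / 2 by rewrite divr_gt0.
have /choice[f fP] (a : S) : exists b, D b /\ mdist a b <= e / 2.
  (* Density applies to nonempty open sets, hence the interior of the ball, which contains [a]. *)
  have [|b [ab Db]] := D_dense (ball a (e / 2))° _ (@open_interior _ _).
    by exists a; exact: nbhsx_ballx.
  exists b; split => //.
  by move: (interior_subset ab); rewrite ballEmdist => /ltW.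
exists (f @` (A : {fset S}))%fset; split; last first.
  by move=> _ /imfsetP[a _ ->]; have [] := fP a.
apply: eU; rewrite ball_finite_subsetsE/=.
apply: (@le_lt_trans _ _ (e / 2)%:E).
  by apply: hausdorff_dist_imfset_le => [|a _]; [exact: ltW|have [] := fP a].
by rewrite lte_fin ltr_pdivrMr// ltr_pMr// ltr1n.
Qed.
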